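(* Let $A\in\mathcal{PC}_{n}$ be a column perturbed consistent matrix. Then both the Perron vector of $AA^{T}$ and the right Perron vector of $A$ lie in $\mathcal{E}(A)$.
   Context: An $n$-by-$n$ entrywise positive real matrix $A=[a_{ij}]$ is reciprocal if $a_{ji}=1/a_{ij}$ for all $1\le i,j\le n$ (so diagonal entries are $1$); $\mathcal{PC}_n$ denotes the set of such matrices. A matrix $A\in\mathcal{PC}_n$ is consistent if $a_{ik}=a_{ij}a_{jk}$ for all $i,j,k$. For an entrywise positive vector $w\in\mathbb{R}^n$, $w^{(-T)}$ is the row vector with entries $1/w_j$, so $ww^{(-T)}=[w_i/w_j]$. $A\in\mathcal{PC}_n$ is a column perturbed consistent matrix if it has a consistent $(n-1)$-by-$(n-1)$ principal submatrix, i.e., there is an index $k$ such that $a_{il}=a_{ij}a_{jl}$ for all $i,j,l\in\{1,\dots,n\}\setminus\{k\}$ (equivalently, $A$ is a reciprocal matrix obtained from a consistent matrix by modifying one column and the corresponding row). A positive vector $w\in\mathbb{R}^n$ is efficient for $A\in\mathcal{PC}_n$ if for every positive vector $v\in\mathbb{R}^n$, the entrywise inequality $|A-vv^{(-T)}|\le |A-ww^{(-T)}|$ (entrywise absolute values) implies that $v$ is proportional to $w$. $\mathcal{E}(A)$ denotes the set of all positive vectors efficient for $A$. The (right) Perron vector of an entrywise positive square matrix $M$ is the entrywise positive (right) eigenvector of $M$ associated with its spectral radius $\rho(M)$; it is unique up to a positive scalar factor. *)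

(* Defs.v *)
From mathcomp Require Import all_boot all_order all_algebra.
From mathcomp Require Import classical_sets reals.
From mathcomp Require Export complex.

Set Implicit Arguments.
Unset Strict Implicit.
Unset Printing Implicit Defensive.

Import Order.TTheory GRing.Theory Num.Theory.

Local Open Scope classical_set_scope.
Local Open Scope ring_scope.
Local Open Scope complex_scope.

Definition mx_positive (R : realType) (m n : nat) (M : 'M[R]_(m, n)) : Prop :=
  forall i j, 0 < M i j.

Definition reciprocal_mx (R : realType) (n : nat) (A : 'M[R]_n) : Prop :=
  mx_positive A /\ forall i j, A j i = (A i j)^-1.

Definition consistent_mx (R : realType) (n : nat) (A : 'M[R]_n) : Prop :=
  reciprocal_mx A /\ forall i j k, A i k = A i j * A j k.

(* [row' k (col' k A)] is the principal submatrix of A obtained by deleting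
   row and column k. *)
Definition column_perturbed_consistent (R : realType) (n : nat)
    (A : 'M[R]_n) : Prop :=
  reciprocal_mx A /\ exists k : 'I_n, consistent_mx (row' k (col' k A)).

(* The row vector w^(-T). *)
Definition invT (R : realType) (n : nat) (w : 'cV[R]_n) : 'rV[R]_n :=
  \row_j (w j 0)^-1.

(* For positive vectors, v = c *: w forces c > 0 (when n > 0), so no sign
   condition on c is needed. *)
Definition proportional (R : realType) (n : nat) (v w : 'cV[R]_n) : Prop :=
  exists c : R, v = c *: w.

Definition efficient_vectors (R : realType) (n : nat) (A : 'M[R]_n) :
    set 'cV[R]_n :=
  [set w | mx_positive w /\
    forall v : 'cV[R]_n, mx_positive v ->
      (forall i j, `|(A - v *m invT v) i j| <= `|(A - w *m invT w) i j|) ->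
      proportional v w].

(* The largest modulus of a complex eigenvalue. [eigenvalue] refers to left
   (row) eigenvectors; left and right eigenvalues coincide. *)
Definition spectral_radius (R : realType) (n : nat) (M : 'M[R]_n) : R :=
  sup [set r : R | exists2 z : R[i],
         eigenvalue (map_mx (real_complex R) M) z & r = Normc.normc z].

(* w is a right Perron vector of M; for M positive these are exactly the
   positive multiples of one vector. *)
Definition perron_vector (R : realType) (n : nat) (M : 'M[R]_n)
    (w : 'cV[R]_n) : Prop :=
  mx_positive w /\ M *m w = spectral_radius M *: w.

(* Main.v *)
(** For a column perturbed consistent matrix [A], every positive combination
    [w = A *m z] of the columns is efficient; both Perron vectors have this form.
    Draw an arc from [i] to [j] when [A i j * w j <= w i]: if [v] approximates
    [A] at least as well as [w], then [v i / w i <= v j / w j] along every arc, so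
    it is enough that every vertex lies on a closed walk through the perturbed
    index [k].  If [i] and [j] differ from [k], then consistency gives
    [w i - A i j * w j = (A i k - A i j * A j k) * z k], so the arcs outside [k]
    form a total preorder; there is an arc from its bottom to [k] and one from
    [k] to its top. *)
Require Import Defs.
From mathcomp Require Import all_boot all_order all_algebra.
From mathcomp Require Import classical_sets reals.
From mathcomp Require Import lra.

Import Order.TTheory GRing.Theory Num.Theory.

Local Open Scope classical_set_scope.
Local Open Scope ring_scope.

(** As [w1 / w2] is at least [a], a larger [v1 / v2] would have a larger error. *)
Lemma ratio_le_of_error_le (R : realFieldType) (a v1 v2 w1 w2 : R) :
    0 < v1 -> 0 < v2 -> 0 < w1 -> 0 < w2 ->
    `|a - v1 / v2| <= `|a - w1 / w2| -> a * w2 <= w1 ->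
  v1 / w1 <= v2 / w2.
Proof.
move=> v1_gt0 v2_gt0 w1_gt0 w2_gt0 le_err le_aw.
have le_a : a <= w1 / w2 by rewrite ler_pdivlMr.
have le_vw : v1 / v2 <= w1 / w2.
  move: le_err; rewrite [X in _ <= X]distrC (ger0_norm (x := w1 / w2 - a)) ?subr_ge0 //.
  by rewrite ler_norml => /andP[]; lra.
rewrite ler_pdivrMr // mulrAC ler_pdivlMr //.
by move: le_vw; rewrite ler_pdivrMr // mulrAC ler_pdivlMr // [w1 * _]mulrC.
Qed.

Section ColumnPerturbed.
Set Implicit Arguments.
Unset Strict Implicit.

Variables (R : realType) (n : nat) (A : 'M[R]_n) (k : 'I_n).
Hypothesis A_rec : reciprocal_mx A.
Hypothesis A_cons : consistent_mx (row' k (col' k A)).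

Let A_gt0 i j : 0 < A i j.
Proof. by case: A_rec => + _; apply. Qed.

Lemma reciprocal_mul_sym i j : A i j * A j i = 1.
Proof. by case: A_rec => _ ->; rewrite mulVf ?gt_eqF. Qed.

Lemma reciprocal_diag i : A i i = 1.
Proof.
have := reciprocal_mul_sym i i; have := A_gt0 i i => Aii_gt0 /eqP.
by rewrite -expr2 sqrf_eq1 => /orP[/eqP //|/eqP Aii]; move: Aii_gt0; rewrite Aii; lra.
Qed.

Lemma consistent_off i j l :
  i != k -> j != k -> l != k -> A i l = A i j * A j l.
Proof.
rewrite ![_ == k]eq_sym => /unlift_some[i' -> _] /unlift_some[j' -> _] /unlift_some[l' -> _].
by case: A_cons => _ /(_ i' j' l'); rewrite !mxE.
Qed.

(** Minimise [A p i * A i k] for the fixed reference row [p]: consistency gives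
    [A p l = A p i * A i l], and the factor [A p i] cancels. *)
Lemma bottom_off p : p != k ->
  exists2 i, i != k & forall l, l != k -> A i k <= A i l * A l k.
Proof.
move=> pk; case: (@arg_minP _ _ _ p (fun i => i != k) (fun i => A p i * A i k)) => // i ik le_i.
exists i => // l lk; have /= := le_i l lk.
by rewrite (consistent_off pk ik lk) -mulrA ler_pM2l.
Qed.

Lemma top_off p : p != k ->
  exists2 i, i != k & forall l, l != k -> A i l * A l k <= A i k.
Proof.
move=> pk; case: (@arg_maxP _ _ _ p (fun i => i != k) (fun i => A p i * A i k)) => // i ik le_i.
exists i => // l lk; have /= := le_i l lk.
by rewrite (consistent_off pk ik lk) -mulrA ler_pM2l.
Qed.

Variable z : 'cV[R]_n.
Hypothesis z_gt0 : mx_positive z.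
Let w := A *m z.

Lemma mulmx_pos_gt0 : mx_positive w.
Proof.
move=> i j; rewrite mxE (bigD1 k) //= ltr_pwDl ?mulr_gt0 //.
by apply: sumr_ge0 => l _; rewrite mulr_ge0 ?ltW.
Qed.

Lemma mulmx_le_off i j : i != k -> j != k ->
  A i j * A j k <= A i k -> A i j * w j 0 <= w i 0.
Proof.
move=> ik jk le_ij; rewrite !mxE mulr_sumr; apply: ler_sum => l _.
rewrite mulrA ler_pM2r //; have [->//|lk] := eqVneq l k.
by rewrite (consistent_off ik jk lk).
Qed.

Lemma mulmx_le_bottom i : (forall l, l != k -> A i k <= A i l * A l k) ->
  A i k * w k 0 <= w i 0.
Proof.
move=> le_i; rewrite !mxE mulr_sumr; apply: ler_sum => l _.
rewrite mulrA ler_pM2r //; have [->|lk] := eqVneq l k.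
  by rewrite reciprocal_diag mulr1.
(* The termwise bound [A i k * A k l <= A i l], multiplied by [A l k], is the hypothesis on [i]. *)
by rewrite -(ler_pM2r (A_gt0 l k)) -mulrA reciprocal_mul_sym mulr1 le_i.
Qed.

Lemma mulmx_le_top i : (forall l, l != k -> A i l * A l k <= A i k) ->
  A k i * w i 0 <= w k 0.
Proof.
move=> le_i; rewrite -(ler_pM2l (A_gt0 i k)) mulrA reciprocal_mul_sym mul1r.
rewrite !mxE mulr_sumr; apply: ler_sum => l _.
rewrite mulrA ler_pM2r //; have [->|lk] := eqVneq l k.
  by rewrite reciprocal_diag mulr1.
by rewrite -(ler_pM2r (A_gt0 l k)) -mulrA reciprocal_mul_sym mulr1 le_i.
Qed.

Lemma mulmx_pos_efficient : efficient_vectors A w.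
Proof.
split=> [|v v_gt0 le_err]; first exact: mulmx_pos_gt0.
have w_gt0 := mulmx_pos_gt0.
have ratio_le i j : A i j * w j 0 <= w i 0 -> v i 0 / w i 0 <= v j 0 / w j 0.
  apply: ratio_le_of_error_le => //; have := le_err i j.
  by rewrite !mxE !big_ord1 !mxE.
suff ratio_eq i : v i 0 / w i 0 = v k 0 / w k 0.
  exists (v k 0 / w k 0); apply/matrixP => i j; rewrite ord1 [RHS]mxE -(ratio_eq i).
  by rewrite divfK ?gt_eqF.
have [->//|ik] := eqVneq i k.
(* The closed walk is [k], [t], [i], [b], [k]; the ratios cannot decrease along it, so they all
   agree. *)
have [b bk le_b] := bottom_off ik; have [t tk le_t] := top_off ik.
have kt := ratio_le _ _ (mulmx_le_top le_t).
have bk_le := ratio_le _ _ (mulmx_le_bottom le_b).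
have ti := ratio_le _ _ (mulmx_le_off tk ik (le_t i ik)).
have ib : v i 0 / w i 0 <= v b 0 / w b 0.
  apply/ratio_le/mulmx_le_off => //.
  rewrite -(ler_pM2l (A_gt0 b i)) mulrA reciprocal_mul_sym mul1r.
  exact: le_b.
by apply/le_anti/andP; split; [exact: le_trans ib bk_le | exact: le_trans kt ti].
Qed.

(** Efficiency depends on a vector only through its ratio matrix, which scaling preserves; this lets
    eigenvector equations be used directly. *)
Lemma scaled_mulmx_pos_efficient (u : 'cV[R]_n) (c : R) :
  mx_positive u -> A *m z = c *: u -> efficient_vectors A u.
Proof.
move=> u_gt0 Az; have c_gt0 : 0 < c.
  by have := mulmx_pos_gt0 k 0; rewrite /w Az mxE pmulr_lgt0.
have [_ w_eff] := mulmx_pos_efficient; split=> // v v_gt0 le_err.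
have invT_w : w *m invT w = u *m invT u.
  apply/matrixP => i j; rewrite /w Az !mxE !big_ord1 !mxE.
  by rewrite -mulf_div divff ?gt_eqF // mul1r.
have [|d ->] := w_eff v v_gt0; first by rewrite invT_w.
by exists (d * c); rewrite /w Az scalerA.
Qed.

End ColumnPerturbed.

Theorem corollary14 (R : realType) (n : nat) (A : 'M[R]_n)
    (hA : column_perturbed_consistent A) :
  (forall w : 'cV[R]_n,
      perron_vector (A *m A^T) w -> efficient_vectors A w) /\
  (forall w : 'cV[R]_n,
      perron_vector A w -> efficient_vectors A w).
Proof.
have [A_rec [k A_cons]] := hA; split=> w [w_gt0 Aw].
(* Regroup [A *m A^T *m w] as [A *m z] with [z = A^T *m w]. *)
- have z_gt0 : mx_positive (A^T *m w).
    have [A_gt0 _] := A_rec; move=> i j; rewrite mxE (bigD1 k) //= ltr_pwDl //.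
      by rewrite mxE mulr_gt0.
    by apply: sumr_ge0 => l _; rewrite mxE mulr_ge0 // ltW.
  rewrite -mulmxA in Aw.
  exact: (scaled_mulmx_pos_efficient A_rec A_cons z_gt0 w_gt0 Aw).
(* Here [w] itself serves as [z]. *)
- exact: (scaled_mulmx_pos_efficient A_rec A_cons w_gt0 w_gt0 Aw).
Qed.
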